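(* For all sufficiently large $n\in\mathbb{N}$, $R^{\mathrm{w}}(Q_n,Q_n)\le 0.96\,n^2$.
   Context: $Q_n$ denotes the Boolean lattice of dimension $n$, i.e. the poset of all subsets of an $n$-element set ordered by inclusion. For posets $P$ and $Q$, a weak copy of $P$ in $Q$ is the image of an injective map $\psi\colon P\to Q$ such that for all $X,Y\in P$, $X\le_P Y$ implies $\psi(X)\le_Q\psi(Y)$. A blue/red coloring of a poset assigns to each of its elements the color blue or red; a weak copy is blue (red) if all its elements are blue (red). The weak poset Ramsey number $R^{\mathrm{w}}(P,Q)$ is the least $N\in\mathbb{N}$ such that every blue/red coloring of the elements of $Q_N$ contains a blue weak copy of $P$ or a red weak copy of $Q$. *)

(* Defs.v *)
From HB Require Import structures.
From mathcomp Require Import all_boot all_order.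
Set Implicit Arguments.
Unset Strict Implicit.
Unset Printing Implicit Defensive.
Import Order.TTheory Order.DefaultSetSubsetOrder.

(* DefaultSetSubsetOrder makes inclusion the canonical order on {set 'I_n}. *)
Definition boolean_lattice (n : nat) : finPOrderType _ := {set 'I_n}.

Section WeakCopies.
Context {d d' : Order.disp_t} (P : finPOrderType d) (Q : finPOrderType d').
Local Open Scope order_scope.

Definition weak_embedding (f : {ffun P -> Q}) : bool :=
  injectiveb f && [forall x, forall y, (x <= y) ==> (f x <= f y)].

Definition weak_copy (A : {set Q}) : bool :=
  [exists f : {ffun P -> Q}, weak_embedding f && (A == [set f x | x : P])].

End WeakCopies.

(* true is blue and false is red. *)
Definition coloring (d : Order.disp_t) (Q : finPOrderType d) := {ffun Q -> bool}.

Definition has_mono_copy (d d' : Order.disp_t) (P : finPOrderType d)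
    (Q : finPOrderType d') (c : coloring Q) (b : bool) : bool :=
  [exists A : {set Q}, weak_copy P A && [forall X in A, c X == b]].

Definition weak_arrow (d d' : Order.disp_t) (P : finPOrderType d)
    (Q : finPOrderType d') (N : nat) : bool :=
  [forall c : coloring (boolean_lattice N),
     has_mono_copy P c true || has_mono_copy Q c false].

Lemma boolean_latticeE (n : nat) (A B : boolean_lattice n) :
  (A <= B)%O = ((A : {set 'I_n}) \subset B).
Proof. by []. Qed.

Section LinearExtension.
Context {d : Order.disp_t} (P : finPOrderType d).

Let down (x : P) : nat := #|[pred y : P | (y <= x)%O]|.
Let ext : seq P := sort (fun x y => down x <= down y) (enum P).

Lemma linear_extension :
  exists r : P -> nat, [/\ injective r, forall x, r x < #|P|
    & forall x y : P, (x <= y)%O -> r x <= r y].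
Proof.
have mem_ext x : x \in ext by rewrite mem_sort mem_enum.
have sz : size ext = #|P| by rewrite size_sort cardE.
have srt : sorted (fun x y => down x <= down y) ext.
  by apply: sort_sorted => x y; apply: leq_total.
exists (index^~ ext); split.
- by move=> x y /(congr1 (nth x ext)); rewrite !nth_index.
- by move=> x; rewrite -sz index_mem.
move=> x y; rewrite le_eqVlt => /orP[/eqP-> //|ltxy].
rewrite leqNgt; apply/negP => ltyx.
have tr : transitive (fun x y => down x <= down y).
  by move=> a b c; apply: leq_trans.
have := sorted_ltn_index tr srt y x (mem_ext y) (mem_ext x) ltyx.
rewrite leqNgt => /negP; apply; apply: proper_card.
apply/properP; split.
  by apply/subsetP => z; rewrite !inE => /le_trans; apply; apply: ltW.
by exists y; rewrite !inE ?lexx // lt_geF.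
Qed.

End LinearExtension.

Section MonoChain.
Context {d : Order.disp_t} (P : finPOrderType d) (N : nat).
Variable c : coloring (boolean_lattice N).

Let level (k : nat) : boolean_lattice N := [set i : 'I_N | i < k].

(* A linear extension embeds P weakly in any #|P|-element chain, so #|P| levels
   of colour b suffice; applied to one maximal chain, this bounds weak_ramsey. *)
Lemma mono_chain (b : bool) :
  #|P| <= count (fun k => c (level k) == b) (iota 0 N.+1) ->
  has_mono_copy P c b.
Proof.
rewrite -size_filter; set s := filter _ _ => leP.
have [r [r_inj r_lt r_mono]] := linear_extension P.
have s_srt : sorted ltn s by apply: sorted_filter (iota_ltn_sorted _ _); apply: ltn_trans.
have r_s x : r x < size s by apply: leq_trans (r_lt x) leP.
have s_in x : nth 0 s (r x) \in s by apply: mem_nth.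
have s_le x : nth 0 s (r x) <= N.
  by have := s_in x; rewrite mem_filter mem_iota => /andP[_ /andP[_]].
have level_inj k l : k <= N -> l <= N -> level k = level l -> k = l.
  suff H k' l' : l' <= N -> k' < l' -> level k' <> level l'.
    move=> kN lN e; case: (ltngtP k l) => // lt; first by case: (H _ _ lN lt).
    by case: (H _ _ kN lt).
  move=> lN lt /setP/(_ (Ordinal (leq_trans lt lN))).
  by rewrite !inE /= ltnn lt.
pose f : {ffun P -> boolean_lattice N} := [ffun x => level (nth 0 s (r x))].
apply/existsP; exists [set f x | x : P]; apply/andP; split.
  apply/existsP; exists f; rewrite eqxx andbT; apply/andP; split.
    apply/injectiveP => x y; rewrite !ffunE => /(level_inj _ _ (s_le x) (s_le y)).
    move/eqP; rewrite nth_uniq ?r_s //; first by move/eqP/r_inj.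
    by rewrite filter_uniq ?iota_uniq.
  apply/forallP => x; apply/forallP => y; apply/implyP => /r_mono le_r.
  rewrite !ffunE boolean_latticeE; apply/subsetP => i; rewrite !inE => /leq_trans; apply.
  apply: (sorted_leq_nth leq_trans leqnn) => //; rewrite ?inE ?r_s //.
  by apply: sub_sorted s_srt => a e; apply: ltnW.
apply/forallP => X; apply/implyP => /imsetP[x _ ->].
by rewrite ffunE; have := s_in x; rewrite mem_filter => /andP[].
Qed.

End MonoChain.

Lemma weak_arrow_exists (d d' : Order.disp_t) (P : finPOrderType d)
  (Q : finPOrderType d') : exists N, weak_arrow P Q N.
Proof.
exists (#|P| + #|Q|); apply/forallP => c.
pose level k : boolean_lattice (#|P| + #|Q|) :=
  [set i : 'I_(#|P| + #|Q|) | i < k].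
pose a := fun k => c (level k) == true.
have := count_predC a (iota 0 (#|P| + #|Q|).+1); rewrite size_iota => cnt.
have [leP|ltP] := leqP #|P| (count a (iota 0 (#|P| + #|Q|).+1)).
  by rewrite (mono_chain leP).
rewrite orbC (@mono_chain _ Q _ c false) //.
rewrite (@eq_count _ _ (predC a)); last first.
  by move=> k; rewrite /a /=; case: (c _).
rewrite -(leq_add2l #|P|); apply: leq_trans (leqnSn _) _.
rewrite -[X in X <= _]cnt.
by apply: leq_add => //; apply: ltnW.
Qed.

Definition weak_ramsey (d d' : Order.disp_t) (P : finPOrderType d)
    (Q : finPOrderType d') : nat :=
  ex_minn (weak_arrow_exists P Q).

(* Main.v *)
(* Consecutive intervals of a maximal chain of Q_N are completely comparable, so
   a weak copy of Q_n may be assembled from groups of consecutive levels, each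
   group placed in its own interval.  An interval of dimension d contains a
   majority colour, which hosts a whole level of size at most 2^(d-1); this is
   much cheaper than n dimensions for the levels near the bottom and the top.
   Starting from the bottom of Q_N, and then from the top, such blocks are
   added until some colour has a = n/10 extreme levels at each end (the two
   colours may differ).  For the colour b with more levels in total, each
   missing level is bought with n dimensions: in the blob argument, each set S
   of that level either sees an element of colour b in its n-dimensional blob
   or the blob is a copy of Q_n in the other colour. *)
Require Import Defs.
From mathcomp Require Import all_boot all_order all_algebra.
From mathcomp Require Import zify.
Import Order.TTheory GRing.Theory Num.Theory.

Lemma card_le_inj_on (S T : finType) (y0 : T) (A : {set S}) (B : {set T}) :
  #|A| <= #|B| ->
  exists f : S -> T, {in A, forall x, f x \in B} /\ {in A &, injective f}.
Proof.
rewrite !cardE => leAB; exists (fun x => nth y0 (enum B) (index x (enum A))).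
have lt x : x \in A -> index x (enum A) < size (enum B).
  by move=> xA; apply: leq_trans leAB; rewrite index_mem mem_enum.
split=> [x xA|x y xA yA].
  by rewrite -mem_enum mem_nth ?lt.
move/eqP; rewrite nth_uniq ?enum_uniq ?lt // => /eqP /(congr1 (nth x (enum A))).
by rewrite !nth_index ?mem_enum.
Qed.

(** * Stacking monochromatic blocks of levels along a maximal chain *)

Section Stacking.
Variables (n N : nat) (c : {set 'I_N} -> bool).
Implicit Types (X Y S T : {set 'I_n}) (b : bool).

Definition segment (k : nat) : {set 'I_N} := [set x : 'I_N | x < k].

Lemma segmentS k l : k <= l -> segment k \subset segment l.
Proof. by move=> kl; apply/subsetP => x; rewrite !inE => /leq_trans; apply. Qed.

Lemma card_segment k : k <= N -> #|segment k| = k.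
Proof.
move=> kN; have inj : injective (@widen_ord k N kN).
  by move=> i j /(congr1 val) /= /val_inj.
rewrite -[RHS]card_ord -(card_imset _ inj).
apply: eq_card => x; rewrite inE; apply/idP/imsetP => [xk|[i _ ->]]; last by rewrite /= ltn_ord.
by exists (Ordinal xk) => //; apply: val_inj.
Qed.

Lemma segment_proper k l : k < l -> l <= N -> segment k \proper segment l.
Proof.
move=> kl lN; rewrite properEcard segmentS ?(ltnW kl) //.
by rewrite !card_segment ?kl // (leq_trans (ltnW kl) lN).
Qed.

(* Images lie in a half-open interval so that consecutive intervals are disjoint. *)
Definition levels_embed b (lo hi k l : nat) : Prop :=
  exists f : {set 'I_n} -> {set 'I_N},
  [/\ forall X, lo <= #|X| < hi ->
        [/\ c (f X) = b, segment k \subset f X & f X \proper segment l],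
      forall X Y, lo <= #|X| < hi -> lo <= #|Y| < hi -> f X = f Y -> X = Y
    & forall X Y, lo <= #|X| < hi -> lo <= #|Y| < hi ->
        X \subset Y -> f X \subset f Y].

Lemma levels_embed0 b lo k l : levels_embed b lo lo k l.
Proof. by exists (fun=> set0); split=> [X|X Y|X Y]; lia. Qed.

Lemma levels_embed_widen b lo hi k l k' l' :
  k' <= k -> l <= l' -> levels_embed b lo hi k l -> levels_embed b lo hi k' l'.
Proof.
move=> kk ll [f [fc finj fmono]]; exists f; split=> // X /fc[cX kX Xl]; split=> //.
  exact: subset_trans (segmentS _ _ kk) kX.
exact: proper_sub_trans Xl (segmentS _ _ ll).
Qed.

(** Images of the lower block lie properly inside [segment p], and those of the upper block contain
    it, so sets from different blocks have distinct, correctly ordered images. *)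
Lemma levels_embed_cat b lo m hi k p l :
  k <= p -> p <= l ->
  levels_embed b lo m k p -> levels_embed b m hi p l -> levels_embed b lo hi k l.
Proof.
move=> kp pl [f [fc finj fmono]] [g [gc ginj gmono]].
have cross X Y : lo <= #|X| < m -> m <= #|Y| < hi -> f X \proper g Y.
  by move=> /fc[_ _ Xp] /gc[_ pY _]; apply: proper_sub_trans Xp pY.
have split_range X : lo <= #|X| < hi ->
    if #|X| < m then lo <= #|X| < m else m <= #|X| < hi by case: ifP; lia.
exists (fun X => if #|X| < m then f X else g X); split.
- move=> X /split_range; case: ifP => _ /=.
    move=> /fc[cX kX Xp]; split=> //; exact: proper_sub_trans Xp (segmentS _ _ pl).
  by move=> /gc[cX pX Xl]; split=> //; apply: subset_trans (segmentS _ _ kp) pX.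
- move=> X Y /split_range + /split_range; case: ifP => _; case: ifP => _ hX hY e.
  + exact: finj.
  + by have := cross _ _ hX hY; rewrite e properxx.
  + by have := cross _ _ hY hX; rewrite e properxx.
  + exact: ginj.
- move=> X Y /split_range + /split_range; case: ifP => Xm; case: ifP => Ym hX hY sXY.
  + exact: fmono.
  + exact: proper_sub (cross _ _ hX hY).
  + by have := subset_leq_card sXY; lia.
  + exact: gmono.
Qed.

(** A level is an antichain, so every injection of it into [A] is monotone. *)
Lemma level_embed b i k l (A : {set {set 'I_N}}) :
  {in A, forall Z, [/\ c Z = b, segment k \subset Z & Z \proper segment l]} ->
  'C(n, i) <= #|A| -> levels_embed b i i.+1 k l.
Proof.
move=> hA; rewrite -[n]card_ord -card_draws => /(card_le_inj_on _ _ set0)[f [fA finj]].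
have lev X : i <= #|X| < i.+1 -> X \in [set X : {set 'I_n} | #|X| == i].
  by rewrite inE; lia.
exists f; split=> [X /lev/fA/hA //|X Y /lev hX /lev hY|X Y hX hY sXY].
  exact: finj.
suff -> : X = Y by [].
by apply/eqP; rewrite eqEcard sXY; lia.
Qed.

(** Pigeonhole on the interval without its top, which has [2 ^ (l - k) - 1] elements: fewer than
    ['C(n, i)] blue ones leave at least ['C(n, j)] red ones, so losing the top costs nothing. *)
Lemma block_embed i j k l : k <= l -> l <= N ->
  'C(n, i) + 'C(n, j) <= 2 ^ (l - k) ->
  levels_embed true i i.+1 k l \/ levels_embed false j j.+1 k l.
Proof.
move=> kl lN big; pose D := segment l :\: segment k.
pose A := [set segment k :|: U | U in powerset D :\ D].
have cardD : #|D| = l - k.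
  rewrite cardsD (setIidPr (segmentS _ _ kl)) !card_segment //; exact: leq_trans lN.
have inj : {in powerset D :\ D &, injective (fun U => segment k :|: U)}.
  have cancel U : U \in powerset D :\ D -> (segment k :|: U) :\: segment k = U.
    rewrite !inE => /andP[_ /subsetP sU]; apply/setP => x; rewrite !inE.
    case: (boolP (x \in U)) => [/sU|_]; last by rewrite orbF andNb.
    by rewrite !inE orbT andbT => /andP[].
  by move=> U V hU hV e; rewrite -(cancel _ hU) -(cancel _ hV) e.
have cardA : #|A| = (2 ^ (l - k)).-1.
  rewrite card_in_imset // -cardD -card_powerset (cardsD1 D (powerset D)).
  by rewrite inE subxx.
have hA Z : Z \in A -> segment k \subset Z /\ Z \proper segment l.
  case/imsetP => U; rewrite !inE => /andP[UD sU] ->; split; first exact: subsetUl.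
  rewrite properEneq subUset segmentS // (subset_trans sU) ?subsetDl // !andbT.
  apply: contraNneq UD => e; rewrite eqEsubset sU; apply/subsetP => x.
  by rewrite 2!inE -e !inE => /andP[/negPf->].
have pos : 0 < 2 ^ (l - k) by rewrite expn_gt0.
have sum := cardsID [set Z | c Z] A; rewrite cardA in sum.
move: (2 ^ (l - k)) pos big sum => m pos big sum.
have [ci|ci] := leqP 'C(n, i) #|A :&: [set Z | c Z]|.
  left; apply: level_embed ci => Z; rewrite 2!inE => /andP[/hA[? ?]]; split=> //.
right; apply: (@level_embed _ _ _ _ (A :\: [set Z | c Z])); last first.
  by move: #|A :&: _| #|A :\: _| sum ci => x y; lia.
by move=> Z; rewrite 2!inE => /andP[/negPf ? /hA[? ?]]; split.
Qed.

(** * The blob argument *)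

Definition shifted (p : nat) S : {set 'I_N} :=
  [set x : 'I_N | [exists i in S, val x == p + i]].

Lemma shiftedS p S T : S \subset T -> shifted p S \subset shifted p T.
Proof.
move=> /subsetP sST; apply/subsetP => x; rewrite !inE => /exists_inP[i iS e].
by apply/exists_inP; exists i => //; apply: sST.
Qed.

Lemma shifted_range p S x : x \in shifted p S -> p <= x < p + n.
Proof. by rewrite inE => /exists_inP[i _ /eqP->]; have := ltn_ord i; lia. Qed.

Lemma mem_shifted p S (i : 'I_n) (h : p + i < N) : (Ordinal h \in shifted p S) = (i \in S).
Proof.
rewrite inE; apply/exists_inP/idP => [[j jS]|iS]; last by exists i.
by rewrite /= eqn_add2l => /eqP/val_inj->.
Qed.

(* [S] is copied onto the coordinates [k, k+n); each cardinality of [S] owns a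
   further [n] coordinates, on which [T] lives. *)
Lemma blob_embed b lo hi k l :
  k + n + n * (hi - lo) < l -> l <= N ->
  levels_embed b lo hi k l \/ levels_embed (~~ b) 0 n.+1 k l.
Proof.
move=> kl lN; pose q S := k + n + n * (#|S| - lo).
(* The third clause fills the coordinates owned by the smaller cardinalities, so enlarging [S]
   strictly swallows any earlier [T]. *)
pose g S T := [set x : 'I_N | [|| x < k, x \in shifted k S,
  (k + n <= x) && (x < q S) | x \in shifted (q S) T]].
have in_g S T x : x \in g S T = [|| x < k, x \in shifted k S,
  (k + n <= x) && (x < q S) | x \in shifted (q S) T] by rewrite inE.
have q_ge S : k + n <= q S by rewrite leq_addr.
have q_room S : lo <= #|S| < hi -> q S + n < l.
  move=> hS; apply: leq_ltn_trans kl; rewrite /q -addnA -mulnSr.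
  by rewrite leq_add2l leq_mul2l; lia.
have g_lower S T : segment k \subset g S T.
  by apply/subsetP => x; rewrite in_g [_ \in segment _]inE => ->.
have g_upper S T : lo <= #|S| < hi -> g S T \proper segment l.
  move=> /q_room hS; apply: sub_proper_trans (segment_proper _ _ hS lN).
  have qk := q_ge S.
  apply/subsetP => x; rewrite in_g [_ \in segment _]inE => /or4P[| /shifted_range | |/shifted_range]; lia.
have g_injl S S' T T' : lo <= #|S| < hi -> lo <= #|S'| < hi ->
    g S T = g S' T' -> S = S'.
  move=> hS hS' e; apply/setP => i.
  have h : k + i < N by have := q_room _ hS; have := q_ge S; have := ltn_ord i; lia.
  have mem S0 T0 : lo <= #|S0| < hi -> (Ordinal h \in g S0 T0) = (i \in S0).
    move=> h0; rewrite in_g mem_shifted /=; case: (i \in S0); rewrite ?orbT //=.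
    apply/negP => /or3P[||/shifted_range] /=; have := q_ge S0; have := ltn_ord i; lia.
  by rewrite -(mem S T) // e mem.
have g_injr S T T' : lo <= #|S| < hi -> g S T = g S T' -> T = T'.
  move=> hS e; apply/setP => i.
  have h : q S + i < N by have := q_room _ hS; have := ltn_ord i; lia.
  have mem T0 : (Ordinal h \in g S T0) = (i \in T0).
    rewrite in_g mem_shifted /=; case: (i \in T0); rewrite ?orbT ?orbF //=.
    apply/negP => /or3P[|/shifted_range|] /=; have := q_ge S; lia.
  by rewrite -(mem T) e mem.
have g_monol S S' T T' : lo <= #|S| < hi -> S \proper S' -> g S T \subset g S' T'.
  move=> hS /[dup] /proper_card lt /proper_sub sS.
  have qq : q S + n <= q S' by rewrite /q -addnA -mulnSr leq_add2l leq_mul2l; lia.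
  have kq := q_ge S.
  apply/subsetP => x; rewrite !in_g => /or4P[->//|xS|xq|/shifted_range xT].
  - by rewrite (subsetP (shiftedS _ _ _ sS) _ xS) orbT.
  - by apply/or4P/Or43; lia.
  - by apply/or4P/Or43; lia.
have g_monor S T T' : T \subset T' -> g S T \subset g S T'.
  move=> sT; apply/subsetP => x; rewrite !in_g => /or4P[->|->|->|xT]; rewrite ?orbT //.
  by rewrite (subsetP (shiftedS _ _ _ sT) _ xT) !orbT.
(* Either one blob avoids [b] and is a full copy of the other colour, or every blob offers a [T] of
   colour [b]. *)
have [/existsP[S /andP[hS /forallP opp]]|] :=
  boolP [exists S : {set 'I_n}, (lo <= #|S| < hi) && [forall T, c (g S T) != b]].
  right; exists (g S); split=> [X _|X Y _ _|X Y _ _].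
  - by split; [have := opp X; case: (c _); case: (b) | exact: g_lower | exact: g_upper].
  - exact: g_injr.
  - exact: g_monor.
rewrite negb_exists => /forallP none; left.
(* The choices for different [S] need no compatibility, by [g_monol]; the default [set0] can occur
   only outside the range. *)
pose t S := odflt set0 [pick T | c (g S T) == b].
have tP S : lo <= #|S| < hi -> c (g S (t S)) = b.
  move=> hS; rewrite /t; case: pickP => [T /eqP //|no].
  by have := none S; rewrite hS /= => /negP; case; apply/forallP => T; rewrite no.
exists (fun S => g S (t S)); split=> [X hX|X Y hX hY|X Y hX hY sXY].
- by split; [exact: tP | exact: g_lower | exact: g_upper].
- exact: g_injl.
- have [->//|ne] := eqVneq X Y.
  by apply: g_monol; rewrite // properEneq ne.
Qed.

End Stacking.

(** * Greedy filling of the extreme levels and its numerical cost *)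

(* [P b i p] reads: [i] levels of colour [b] fit within [p] coordinates.  The
   state [(i, j)] is reached within the potential
   [\sum_(k < maxn i j) w k + minn i j * w a.-1]. *)
Lemma greedy_levels (a M : nat) (w : nat -> nat) (P : bool -> nat -> nat -> Prop) :
  {homo w : i j / i <= j} ->
  (forall b p, P b 0 p) ->
  (forall b i p p', p <= p' -> P b i p -> P b i p') ->
  (forall i j p, i < a -> j < a -> p + w (maxn i j) <= M ->
     P true i p -> P false j p ->
     P true i.+1 (p + w (maxn i j)) \/ P false j.+1 (p + w (maxn i j))) ->
  \sum_(k < a) w k + a * w a.-1 <= M ->
  exists i j, [/\ maxn i j = a,
    P true i (\sum_(k < a) w k + minn i j * w a.-1)
    & P false j (\sum_(k < a) w k + minn i j * w a.-1)].
Proof.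
move=> wS P0 PS step roomM; pose W := w a.-1.
pose s x := \sum_(k < x) w k; pose cost i j := s (maxn i j) + minn i j * W.
have sS x : s x.+1 = s x + w x by rewrite /s big_ord_recr.
have s_mono x y : x <= y -> s x <= s y.
  by move=> /subnK<-; elim: (y - x) => // m IH; rewrite addSn sS; lia.
have costC i j : cost i j = cost j i by rewrite /cost maxnC minnC.
(* Raising the maximum adds exactly [w (maxn i j)] to the potential; raising the strictly smaller
   index adds [W], which dominates it. *)
have cost_step i j : i < a -> j < a -> cost i j + w (maxn i j) <= cost i.+1 j.
  move=> ia ja; rewrite /cost; have [ji|ij] := leqP j i.
    have [-> ->] : maxn i.+1 j = i.+1 /\ minn i.+1 j = j by lia.
    by rewrite sS; lia.
  have [-> ->] : maxn i.+1 j = j /\ minn i.+1 j = i.+1 by lia.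
  have wj : w j <= W by apply: wS; lia.
  by rewrite mulSn; lia.
have cost_room i j : i < a -> j < a -> cost i j + w (maxn i j) <= M.
  move=> ia ja; apply: leq_trans roomM; rewrite /cost addnAC -sS.
  by apply: leq_add; [apply: s_mono; lia | rewrite leq_mul2r; lia].
(* Here [m] counts the blocks placed; [2 * a] of them force the maximum up to [a]. *)
suff H m : exists i j, [/\ maxn i j <= a, (i + j = m) \/ maxn i j = a,
    P true i (cost i j) & P false j (cost i j)].
  have [i [j [le_a e Pi Pj]]] := H a.*2.
  have ea : maxn i j = a by lia.
  by exists i, j; move: Pi Pj; rewrite /cost ea.
elim: m => [|m [i [j [le_a e Pi Pj]]]].
  by exists 0, 0; split; [lia | left | exact: P0 | exact: P0].
have [ea|na] := eqVneq (maxn i j) a; first by exists i, j; split=> //; right.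
have [ia ja] : i < a /\ j < a by lia.
have leI := cost_step _ _ ia ja; have leJ := cost_step _ _ ja ia.
rewrite maxnC [cost j i]costC [cost j.+1 i]costC in leJ.
have wj : cost i j <= cost i j.+1 by lia.
have wi : cost i j <= cost i.+1 j by lia.
have [Pi'|Pj'] := step _ _ _ ia ja (cost_room _ _ ia ja) Pi Pj.
  exists i.+1, j; split; [lia | lia | exact: PS leI Pi' | exact: PS wi Pj].
exists i, j.+1; split; [lia | lia | exact: PS wj Pi | exact: PS leJ Pj'].
Qed.

(* Evaluate [(16 + 1) ^ n] binomially and use [(17 / 16) ^ 11 < 2]. *)
Lemma bin_le_exp2 n k : 'C(n, k) <= 2 ^ (n %/ 11 + 1 + 4 * k).
Proof.
have [kn|nk] := leqP k n; last by rewrite bin_small.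
(* Each full group of 11 factors costs one doubling, and the remainder one more. *)
have pow_le (A B : nat) : A ^ 11 <= 2 * B ^ 11 ->
    (forall r, r < 11 -> A ^ r <= 2 * B ^ r) -> A ^ n <= B ^ n * 2 ^ (n %/ 11 + 1).
  move=> le11 /(_ _ (ltn_pmod n (isT : 0 < 11))) le_r.
  rewrite {1 2}(divn_eq n 11) !expnD mulnACA ![n %/ 11 * 11]mulnC !expnM -expnMn.
  rewrite expn1; apply: leq_mul; last by rewrite mulnC.
  have [->|q0] := posnP (n %/ 11); first by rewrite !expn0.
  by rewrite (leq_exp2r _ _ q0) mulnC.
have pow17 : 17 ^ n <= 16 ^ n * 2 ^ (n %/ 11 + 1).
  apply: pow_le; first by lia.
  by do 11![case; first by lia].
(* This keeps one term of the expansion; dividing by [16 ^ (n - k)] later leaves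
   [16 ^ k = 2 ^ (4 * k)]. *)
have le17 : 'C(n, k) * 16 ^ (n - k) <= 17 ^ n.
  rewrite -[17]/(16 + 1) expnDn.
  rewrite (bigD1 (Ordinal (kn : k < n.+1))) //= exp1n muln1.
  by rewrite leq_addr.
have p16 : 0 < 16 ^ (n - k) by rewrite expn_gt0.
rewrite -(leq_pmul2r p16); apply: leq_trans le17 (leq_trans pow17 _).
rewrite -{1}(subnK kn) expnD [2 ^ (_ + 4 * k)]expnD (expnM 2 4).
by rewrite -mulnA mulnC [16 ^ k * _]mulnC.
Qed.

(* With [a = n / 10] and [w k = n / 11 + 2 + 4 k] one has [w a.-1 <= n / 2], so an
   excess of [m] levels in the losing colours costs at most [m n / 2]; it also
   raises the number of levels won by the better colour by [m / 2]. *)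
Lemma mono_levels n N (c : {set 'I_N} -> bool) :
  2000 <= n -> N = 96 * n ^ 2 %/ 100 ->
  exists b, levels_embed n N c b 0 n.+1 0 N.
Proof.
move=> n_big eN; pose a := n %/ 10; pose q := n %/ 11; pose w k := q + 2 + 4 * k.
pose s := \sum_(k < a) w k; pose W := w a.-1.
have wS : {homo w : i j / i <= j} by move=> i j; rewrite /w; lia.
(* The sum of two binomials costs one more doubling, hence the 2 in [w]. *)
have bin_w i j : 'C(n, i) + 'C(n, j) <= 2 ^ w (maxn i j).
  have -> : w (maxn i j) = (q + 1 + 4 * maxn i j).+1 by rewrite /w; lia.
  rewrite expnS mul2n -addnn; apply: leq_add; apply: leq_trans (bin_le_exp2 _ _) _.
    by rewrite leq_pexp2l //; lia.
  by rewrite leq_pexp2l //; lia.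
have s2 : 2 * s = 2 * a * q + 4 * a * a.
  rewrite /s; elim: (a) => [|m IH]; first by rewrite big_ord0 !muln0.
  by rewrite big_ord_recr /= mulnDr IH /w; nia.
have W2 : 2 * W <= n by rewrite /W /w /a /q; lia.
(* The coefficients of [n ^ 2] are about 2/110 + 4/100 + 1 on the left and 0.96 + 0.1 on the right.
   The gap is below 0.002, so a large [n] is needed to absorb the linear terms. *)
have budget : 2 * s + n * n + 2 * n + 1 <= N + n * a.
  have na : 10 * a <= n < 10 * a + 10 by rewrite /a; lia.
  have nq : 11 * q <= n by rewrite /q; lia.
  have nN : 96 * (n * n) < 100 * N + 100 by rewrite eN; lia.
  rewrite s2; nia.
have a_n : 10 * a <= n by rewrite /a; lia.
have aW : 2 * (a * W) <= n * a by nia.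
have room : s + a * W <= N by nia.
have [i [j [eij Pi Pj]]] : exists i j, [/\ maxn i j = a,
    levels_embed n N c true 0 i 0 (s + minn i j * W)
  & levels_embed n N c false 0 j 0 (s + minn i j * W)].
  apply: (@greedy_levels a N w (fun b i p => levels_embed n N c b 0 i 0 p)) => //.
  - by move=> b p; apply: levels_embed0.
  - by move=> b i p p' pp; apply: levels_embed_widen.
  move=> i j p ia ja pN Pi Pj.
  have [|||E|E] := @block_embed n N c i j p (p + w (maxn i j)).
  - exact: leq_addr.
  - exact: pN.
  - by rewrite addKn bin_w.
  - by left; apply: levels_embed_cat Pi E; rewrite ?leq_addr.
  - by right; apply: levels_embed_cat Pj E; rewrite ?leq_addr.
(* The same greedy process runs downwards from the top; symmetry of binomials gives the same
   widths. *)
have [i' [j' [eij' Pi' Pj']]] : exists i j, [/\ maxn i j = a,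
    levels_embed n N c true (n.+1 - i) n.+1 (N - (s + minn i j * W)) N
  & levels_embed n N c false (n.+1 - j) n.+1 (N - (s + minn i j * W)) N].
  apply: (@greedy_levels a N w
    (fun b i p => levels_embed n N c b (n.+1 - i) n.+1 (N - p) N)) => //.
  - by move=> b p; rewrite subn0; apply: levels_embed0.
  - by move=> b x p p' pp; apply: levels_embed_widen; lia.
  move=> i0 j0 p ia ja pN Pi0 Pj0.
  have [|||E|E] := @block_embed n N c (n - i0) (n - j0) (N - (p + w (maxn i0 j0))) (N - p).
  - by lia.
  - by lia.
  - rewrite !bin_sub; [|lia|lia].
    by have -> : N - p - (N - (p + w (maxn i0 j0))) = w (maxn i0 j0) by lia.
  - left; rewrite subSS; apply: levels_embed_cat E _; [lia|lia|].
    by have -> : (n - i0).+1 = n.+1 - i0 by lia.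
  - right; rewrite subSS; apply: levels_embed_cat E _; [lia|lia|].
    by have -> : (n - j0).+1 = n.+1 - j0 by lia.
set p := s + _ in Pi Pj; set p' := s + _ in Pi' Pj'.
(* With [x] bottom and [y] top levels of colour [b], the blob argument supplies the middle or a full
   copy in the other colour. *)
have finish b x y : levels_embed n N c b 0 x 0 p ->
    levels_embed n N c b (n.+1 - y) n.+1 (N - p') N ->
    x + y <= n -> i + j + (i' + j') <= 2 * (x + y) ->
    exists b, levels_embed n N c b 0 n.+1 0 N.
  move=> Px Py xy big.
  have fits : p + n + n * (n.+1 - y - x) + p' < N.
    have -> : n.+1 - y - x = n.+1 - (x + y) by lia.
    (* Since both maxima are [a], the four counts sum to [2 * a] plus the two minima. As
       [2 * W <= n], what the minima cost is repaid by the levels they save, leaving [budget]. *)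
    have mm : 2 * a + (minn i j + minn i' j') <= 2 * (x + y) by lia.
    rewrite /p /p' mulnBr; move: (minn i j) (minn i' j') (x + y) mm xy => m m' z mm zn.
    have cost : (m + m') * (2 * W) <= (m + m') * n by rewrite leq_mul2l W2 orbT.
    have gain : n * (2 * a + (m + m')) <= n * (2 * z) by rewrite leq_mul2l mm orbT.
    have nz : n * z <= n * n.+1 by rewrite leq_mul2l (leqW zn) orbT.
    clear - budget cost gain nz; lia.
  have pN : p + n + n * (n.+1 - y - x) < N - p' by lia.
  have [mid|full] := @blob_embed n N c b x (n.+1 - y) p (N - p') pN (leq_subr _ _).
    have pp : p <= N - p' by apply: leq_trans (ltnW pN); rewrite -addnA leq_addr.
    exists b; apply: (@levels_embed_cat _ _ _ _ _ x _ _ p) => //; first by lia.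
    by apply: levels_embed_cat mid Py; rewrite ?leq_subr.
  by exists (~~ b); apply: levels_embed_widen full; rewrite ?leq_subr.
(* The better colour owns at least half of all the levels placed. *)
have [le|lt] := leqP (j + j') (i + i').
  by apply: finish Pi Pi' _ _; lia.
by apply: finish Pj Pj' _ _; lia.
Qed.

(** * Transfer to [weak_ramsey] and the rational bound *)

Local Open Scope ring_scope.

Theorem theorem5 :
  exists n0 : nat, forall n : nat, (n0 <= n)%N ->
    (weak_ramsey (boolean_lattice n) (boolean_lattice n))%:R
      <= (96%:R / 100%:R) * n%:R ^+ 2 :> rat.
Proof.
exists 2000%N => n n_big; pose N := (96 * n ^ 2 %/ 100)%N.
have leN : (weak_ramsey (boolean_lattice n) (boolean_lattice n) <= N)%N.
  rewrite /weak_ramsey; case: ex_minnP => m _; apply; apply/forallP => c.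
  have [b [f [fc finj fmono]]] := @mono_levels n N c n_big (erefl _).
  have all_levels (X : {set 'I_n}) : (0 <= #|X| < n.+1)%N.
    by rewrite ltnS (leq_trans (max_card _)) ?card_ord.
  suff : has_mono_copy (boolean_lattice n) c b.
    by case: (b) => ->; rewrite ?orbT.
  pose F : {ffun boolean_lattice n -> boolean_lattice N} :=
    [ffun X : boolean_lattice n => f X : boolean_lattice N].
  apply/existsP; exists [set F X | X : boolean_lattice n].
  apply/andP; split.
    apply/existsP; exists F; rewrite eqxx andbT; apply/andP; split.
      by apply/injectiveP => X Y; rewrite !ffunE; apply: finj.
    apply/forallP => X; apply/forallP => Y; apply/implyP.
    by rewrite !ffunE !boolean_latticeE; apply: fmono.
  apply/forallP => Z; apply/implyP => /imsetP[X _ ->].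
  by rewrite ffunE; have [-> _ _] := fc X (all_levels X).
have leN' : (weak_ramsey (boolean_lattice n) (boolean_lattice n) * 100 <= 96 * n ^ 2)%N.
  by rewrite -leq_divRL.
rewrite mulrAC ler_pdivlMr; last by rewrite ltr0n.
by rewrite -natrX -!natrM ler_nat.
Qed.
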